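(* Let $p$ be a prime number and let $G$ be a homogeneous completely decomposable (torsion-free Abelian) group of type $\mathbf{t}(G)=\mathbf{t}(\mathbb{Q}_{p})$. Then $G$ is perspective if and only if $G$ has finite rank.
   Context: An Abelian group $G$ is called perspective if any two isomorphic direct summands of $G$ have a common direct complement: whenever $G=A\oplus H=B\oplus K$ with $A\cong B$, there exists a subgroup $C\le G$ with $G=A\oplus C=B\oplus C$. Here $\mathbb{Q}_p$ denotes the group (ring) of all rational numbers with denominator coprime to $p$ (not the $p$-adic numbers). $\mathbf{t}(\cdot)$ denotes the type. A homogeneous completely decomposable group is a direct sum of rank $1$ torsion-free groups all of the same type; thus the hypothesis means that $G$ is a direct sum of copies of $\mathbb{Q}_p$. *)

(* Defs.v *)
From HB Require Import structures.
From mathcomp Require Import all_boot all_order all_algebra.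
From mathcomp Require Import finmap boolp classical_sets cardinality.

Set Implicit Arguments.
Unset Strict Implicit.
Unset Printing Implicit Defensive.

Import GRing.Theory.
Local Open Scope ring_scope.

(* Subgroups of G are the library's [zmodClosed G].  Their membership is
   boolean, but by [boolp.asbool] every Prop-valued subset of G closed under
   subtraction and containing 0 yields one, so this is no restriction. *)
Record subgroup (G : zmodType) (A : zmodClosed G) : Type :=
  Subgroup { subgroup_val :> G; _ : subgroup_val \in A }.

HB.instance Definition _ (G : zmodType) (A : zmodClosed G) :=
  [isSub for @subgroup_val G A].
HB.instance Definition _ (G : zmodType) (A : zmodClosed G) :=
  [Choice of subgroup A by <:].
HB.instance Definition _ (G : zmodType) (A : zmodClosed G) :=
  [SubChoice_isSubZmodule of subgroup A by <:].

Definition isomorphic (G H : zmodType) : Prop :=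
  exists f : {additive G -> H}, bijective f.

Definition direct_sum2 (G : zmodType) (A C : zmodClosed G) : Prop :=
  (forall x : G, exists a c : G, [/\ a \in A, c \in C & x = a + c]) /\
  (forall x : G, x \in A -> x \in C -> x = 0).

Definition perspective (G : zmodType) : Prop :=
  forall A H B K : zmodClosed G,
    direct_sum2 A H -> direct_sum2 B K ->
    isomorphic (subgroup A) (subgroup B) ->
    exists C : zmodClosed G, direct_sum2 A C /\ direct_sum2 B C.

Definition direct_sum (G : zmodType) (I : choiceType)
    (A : I -> zmodClosed G) : Prop :=
  (forall x : G, exists (S : {fset I}) (a : I -> G),
     (forall i, a i \in A i) /\ x = \sum_(i <- S) a i) /\
  (forall (S : {fset I}) (a : I -> G),
     (forall i, a i \in A i) -> \sum_(i <- S) a i = 0 ->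
     forall i, i \in S -> a i = 0).

Definition torsion_free (G : zmodType) : Prop :=
  forall (x : G) (n : nat), (0 < n)%N -> x *+ n = 0 -> x = 0.

Definition Zindependent (G : zmodType) (n : nat) (v : 'I_n -> G) : Prop :=
  forall c : 'I_n -> int, \sum_(i < n) v i *~ c i = 0 -> forall i, c i = 0.

(* For torsion-free G this is the usual rank; in general it is the
   torsion-free rank. *)
Definition has_rank (G : zmodType) (n : nat) : Prop :=
  (exists v : 'I_n -> G, Zindependent v) /\
  ~ (exists v : 'I_n.+1 -> G, Zindependent v).

Definition finite_rank (G : zmodType) : Prop := exists n, has_rank G n.

Definition divides (G : zmodType) (m : nat) (x : G) : Prop :=
  exists y : G, x = y *+ m.

Definition prime_index : Type := {q : nat | prime q}.

(* [None] stands for infinity. *)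
Definition characteristic : Type := prime_index -> option nat.

Definition height (G : zmodType) (q : nat) (x : G) : option nat :=
  xget None
    [set Some k | k in [set k | divides (q ^ k) x /\ ~ divides (q ^ k.+1) x]].

Definition char_of (G : zmodType) (x : G) : characteristic :=
  fun q => height (val q) x.

Definition char_equiv (c d : characteristic) : Prop :=
  finite_set [set q | c q <> d q] /\
  (forall q, c q <> d q -> c q <> None /\ d q <> None).

(* A type is an equivalence class of characteristics.  In a torsion-free group
   of rank 1 all nonzero elements have equivalent characteristics, so the set
   below is a single class; it is only meant for such groups. *)
Definition type_of (G : zmodType) : set characteristic :=
  [set c | exists2 x : G, x != 0 & char_equiv (char_of x) c].

(* The zero group (I empty) is homogeneous of every type. *)
Definition homogeneous_completely_decomposable
    (G : zmodType) (t : set characteristic) : Prop :=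
  exists (I : choiceType) (A : I -> zmodClosed G),
    direct_sum A /\
    forall i, [/\ torsion_free (subgroup (A i)), has_rank (subgroup (A i)) 1
                & type_of (subgroup (A i)) = t].

(* The localization of Z at p inside rat, not the p-adic numbers. *)
Definition Qp (p : nat) : {pred rat} := [pred x | coprime p `|denq x|].

Lemma Qp_zmod_closed (p : nat) : zmod_closed (Qp p).
Proof.
split=> [|x y]; rewrite !inE; first by rewrite coprimen1.
move=> px py; suff /dvdnP[k Ek] : (`|denq (x - y)| %| `|denq x| * `|denq y|)%N.
  have : coprime p (k * `|denq (x - y)|) by rewrite -Ek coprimeMr px.
  by rewrite coprimeMr => /andP[].
rewrite -abszM -dvdzE.
set d := denq x * denq y; set n := numq x * denq y - numq y * denq x.
have d0 : d != 0 by rewrite mulf_neq0 ?denq_neq0.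
have -> : x - y = n%:~R / d%:~R.
  rewrite -{1}[x]divq_num_den -{1}[y]divq_num_den rmorphB !rmorphM /=.
  have dx : (denq x)%:~R != 0 :> rat by rewrite intr_eq0 denq_neq0.
  have dy : (denq y)%:~R != 0 :> rat by rewrite intr_eq0 denq_neq0.
  by have := addf_div (numq x)%:~R (- (numq y)%:~R) dx dy; rewrite !mulNr.
by case: divqP d0 => // k y0 k0 _; rewrite dvdz_mull.
Qed.

HB.instance Definition _ (p : nat) :=
  GRing.isZmodClosed.Build rat (Qp p) (Qp_zmod_closed p).

(* Main.v *)
From HB Require Import structures.
Require Import Defs.
From mathcomp Require Import all_boot all_order all_algebra.
From mathcomp Require Import finmap boolp classical_sets functions cardinality.

Set Implicit Arguments.
Unset Strict Implicit.
Unset Printing Implicit Defensive.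

Import Order.TTheory GRing.Theory Num.Theory.
Local Open Scope ring_scope.

(** Write Z_(p) for the integers localized at p.  A torsion-free group of rank
1 and of the type of Z_(p) has an element x of p-height 0 which is divisible
by every prime other than p, and then every element is a Z_(p)-multiple of x.
So G is a free Z_(p)-module; a [local_basis] expresses this inside the group
G, without scalars from Z_(p): multiples by integers and divisibility by the
integers prime to p are enough.  Additive maps out of G are determined by
arbitrary values on such a basis ([hom_of_basis], [eq_hom_of_basis]).

If G is perspective, then every one-sided inverse of an endomorphism is
two-sided ([perspective_dedekind_finite]): when t s = 1, the summands G and
s(G) are isomorphic, the only complement of G is 0, hence s(G) = G.  An
infinite basis would allow a shift, which is injective but not surjective.  So
the basis is finite, and then clearing denominators in a kernel over the
rationals bounds the rank of G.

Conversely let G have finite rank, and let e and f be idempotents whose images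
are the two isomorphic summands.  The complement is built from lines common to
both sides.  If e = 1, then f = 1 by comparing ranks and 0 is a common
complement.  Otherwise neither image contains G modulo p, so, a group not
being the union of two proper subgroups, some c avoids im e + pG and
im f + pG.  A coordinate of the component of c in ker e is a unit of Z_(p), so
the pure subgroup L generated by c splits off ([projection_onto_line]): im e + L
and im f + L are again isomorphic direct summands, now of smaller corank.  A
common complement C of the larger pair, which exists by induction
([common_kernel_projections]), yields the common complement L + C of the
original pair. *)

(** * Additive maps and direct decompositions *)

(** Additive maps are constructed from their graphs: this avoids choosing a
formula for the values and then proving it independent of the choices. *)
Lemma additive_of_relation (U V : zmodType) (R : U -> V -> Prop) :
  (forall u, exists v, R u v) ->
  (forall u u' v v', R u v -> R u' v' -> R (u - u') (v - v')) ->
  (forall v, R 0 v -> v = 0) ->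
  exists s : {additive U -> V}, forall u, R u (s u).
Proof.
move=> Rtot RB R0; have [s Rs] := choice Rtot.
have Runiq u v v' : R u v -> R u v' -> v = v'.
  by move=> r /(RB _ _ _ _ r); rewrite subrr => /R0/subr0_eq.
have s_add : zmod_morphism s
  by move=> u v; apply: Runiq (Rs _) (RB _ _ _ _ _ _).
pose a := GRing.isZmodMorphism.Build U V s s_add.
pose S : {additive U -> V} := HB.pack s a.
by exists S.
Qed.

Definition kernel (U V : zmodType) (s : {additive U -> V}) : {pred U} :=
  [pred u | s u == 0].

Lemma kernel_zmod_closed (U V : zmodType) (s : {additive U -> V}) :
  zmod_closed (kernel s).
Proof.
split=> [|u v]; rewrite !inE ?raddf0 // raddfB.
by move=> /eqP-> /eqP->; rewrite subrr.
Qed.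

HB.instance Definition _ (U V : zmodType) (s : {additive U -> V}) :=
  GRing.isZmodClosed.Build U (kernel s) (kernel_zmod_closed s).

Lemma direct_sum2_projection (G : zmodType) (A H : zmodClosed G) :
  direct_sum2 A H ->
  exists e : {additive G -> G},
    [/\ forall x, e x \in A, forall x, x \in A -> e x = x
      & forall x, (x \in H) = (e x == 0)].
Proof.
case=> AH AH0.
have [|||e eP] := @additive_of_relation G G
    (fun x a => a \in A /\ x - a \in H).
- by move=> x; have [a [h [aA hH ->]]] := AH x; exists a; rewrite addrC addKr.
- move=> x y a b [aA xaH] [bA ybH]; split; first exact: rpredB.
  by rewrite opprD addrACA -opprD rpredB.
- by move=> a [aA]; rewrite sub0r rpredN => aH; apply: AH0.
exists e; split=> [x|x xA|x]; first by case: (eP x).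
- have [eA exH] := eP x; apply/esym/subr0_eq/AH0 => //; exact: rpredB.
- have [eA exH] := eP x; apply/idP/eqP => [xH|ex0].
    by apply: AH0 => //; rewrite -[e x](subKr x) rpredB.
  by rewrite ex0 subr0 in exH.
Qed.

(** * Bases over the localization *)

Definition lincomb (I : choiceType) (V : zmodType) (y : I -> V)
    (S : {fset I}) (m : I -> int) : V :=
  \sum_(i <- S) y i *~ m i.

(** A basis of G as a module over the localization of the integers at p, in
terms of the group structure alone.  The elements of G are fractions of
integral combinations of the basis, with denominators prime to p. *)
Record local_basis (p : nat) (G : zmodType) (I : choiceType) (x : I -> G) :
    Prop := LocalBasis {
  lb_torsion_free : torsion_free G;
  lb_divides : forall n (g : G), coprime p n -> divides n g;
  lb_span : forall g : G, exists n S m,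
    coprime p n /\ g *+ n = lincomb x S m;
  lb_indep : forall S m, lincomb x S m = 0 -> forall i, i \in S -> m i = 0 }.

Lemma raddf_lincomb (I : choiceType) (U V : zmodType) (s : {additive U -> V})
    (y : I -> U) S m :
  s (lincomb y S m) = lincomb (s \o y) S m.
Proof. by rewrite raddf_sum; apply: eq_bigr => i _; rewrite raddfMz. Qed.

Lemma lincomb_widen (I : choiceType) (V : zmodType) (y : I -> V)
    (S T : {fset I}) m :
  (S `<=` T)%fset ->
  lincomb y S m = lincomb y T (fun i => if i \in S then m i else 0).
Proof.
move=> sST; rewrite /lincomb -(big_fset_incl _ sST).
  by rewrite !big_seq; apply: eq_bigr => i ->.
by move=> i _ /negbTE ->; rewrite mulr0z.
Qed.

(** The new coefficients do not depend on the family that is combined, so that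
the same S and m serve for the basis and for its prescribed images. *)
Lemma lincomb_sub (I : choiceType) (S1 S2 : {fset I}) (m1 m2 : I -> int)
    (n1 n2 : nat) :
  exists S m, forall (V : zmodType) (y : I -> V),
    lincomb y S m = lincomb y S1 m1 *+ n2 - lincomb y S2 m2 *+ n1.
Proof.
exists (S1 `|` S2)%fset, (fun i => (if i \in S1 then m1 i else 0) * n2%:Z
                               - (if i \in S2 then m2 i else 0) * n1%:Z).
move=> V y.
rewrite (lincomb_widen y m1 (fsubsetUl S1 S2)).
rewrite (lincomb_widen y m2 (fsubsetUr S1 S2)).
rewrite /lincomb -!sumrMnl -sumrB; apply: eq_bigr => i _.
by rewrite mulrzBr !mulrzA.
Qed.

Lemma torsion_freeMz (V : zmodType) (v : V) (k : int) :
  torsion_free V -> k != 0 -> v *~ k = 0 -> v = 0.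
Proof.
move=> tfV k0 vk0; apply: (tfV v `|k|%N); first by rewrite absz_gt0.
case: k k0 vk0 => // k _ /eqP.
by rewrite NegzE mulrNz oppr_eq0 => /eqP.
Qed.

Lemma torsion_free_inj (V : zmodType) (v w : V) (n : nat) :
  torsion_free V -> (0 < n)%N -> v *+ n = w *+ n -> v = w.
Proof.
move=> tfV n0 /eqP; rewrite -subr_eq0 -mulrnBl => /eqP vw.
by apply: subr0_eq; apply: tfV vw.
Qed.

Lemma prime_coprime_gt0 p n : prime p -> coprime p n -> (0 < n)%N.
Proof.
by case: n => // pp; rewrite /coprime gcdn0 => /eqP pE; rewrite pE in pp.
Qed.

(** The universal property of a free module.  The image of g is the v with
n v = sum of m_i y_i whenever n g = sum of m_i x_i with n prime to p. *)
Lemma hom_of_basis (p : nat) (G V : zmodType) (I : choiceType) (x : I -> G)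
    (y : I -> V) :
  prime p -> local_basis p x ->
  torsion_free V -> (forall n (v : V), coprime p n -> divides n v) ->
  exists s : {additive G -> V}, forall i, s (x i) = y i.
Proof.
move=> pp xb tfV divV.
pose R g v := exists n S m,
  [/\ coprime p n, g *+ n = lincomb x S m & v *+ n = lincomb y S m].
have [|||s sP] := @additive_of_relation G V R.
- move=> g; have [n [S [m [pn gn]]]] := lb_span xb g.
  by have [v vn] := divV _ (lincomb y S m) pn; exists v, n, S, m.
- move=> g g' v v' [n [S [m [pn gn vn]]]] [n' [S' [m' [pn' gn' vn']]]].
  have [T [k kE]] := lincomb_sub S S' m m' n n'.
  exists (n * n')%N, T, k; rewrite coprimeMr pn pn' !kE -gn -gn' -vn -vn'.
  by rewrite !mulrnBl -!mulrnA mulnC.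
- move=> v [n [S [m [pn]]]]; rewrite mul0rn => /esym/(lb_indep xb) m0 vn.
  apply: tfV (prime_coprime_gt0 pp pn) _; rewrite vn /lincomb big_seq.
  by apply: big1 => i /m0 ->; rewrite mulr0z.
exists s => i; have [n [S [m [pn xn sn]]]] := sP (x i).
have [T [k kE]] := lincomb_sub [fset i]%fset S (fun=> 1) m 1 n.
have /(lb_indep xb) k0 : lincomb x T k = 0.
  by rewrite kE -xn /lincomb big_seq_fset1 mulr1n mulr1z subrr.
have : lincomb y T k = 0.
  by rewrite /lincomb big_seq; apply: big1 => j /k0->; rewrite mulr0z.
rewrite kE -sn /lincomb big_seq_fset1 mulr1n mulr1z => /subr0_eq/esym.
exact: torsion_free_inj tfV (prime_coprime_gt0 pp pn).
Qed.

Lemma eq_hom_of_basis (p : nat) (G V : zmodType) (I : choiceType) (x : I -> G)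
    (s t : {additive G -> V}) :
  prime p -> local_basis p x -> torsion_free V ->
  (forall i, s (x i) = t (x i)) -> s =1 t.
Proof.
move=> pp xb tfV st g; have [n [S [m [pn gn]]]] := lb_span xb g.
apply: (torsion_free_inj tfV (prime_coprime_gt0 pp pn)).
rewrite -!raddfMn gn !raddf_lincomb; apply: eq_bigr => i _; congr (_ *~ _).
exact: st.
Qed.

(** * Divisibility by p *)

Lemma bezout_coprime (p n : nat) : coprime p n ->
  exists u v : int, u * p%:Z + v * n%:Z = 1.
Proof.
move=> /eqP pn; have [u [v uv]] := Bezoutz p%:Z n%:Z.
by exists u, v; rewrite uv /gcdz !absz_nat pn.
Qed.

Lemma divides_coprime (p n : nat) (G : zmodType) (g : G) :
  coprime p n -> divides p (g *+ n) -> divides p g.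
Proof.
move=> /bezout_coprime[u [v uv]] [h gn].
exists (g *~ u + h *~ v).
rewrite -[LHS]mulr1z -uv mulrzDr [v * _]mulrC !mulrzA -(pmulrn g n) gn mulrnDl.
by congr (_ + _); rewrite !pmulrn -!mulrzA mulrC.
Qed.

Lemma lincomb_delta (I : choiceType) (V : zmodType) (j : I) (d : V) S m :
  lincomb (fun i => if i == j then d else 0) S m =
  if j \in S then d *~ m j else 0.
Proof.
rewrite /lincomb; case: ifPn => jS.
  rewrite (big_rem j) //= eqxx big_seq big1 ?addr0 // => i.
  by rewrite mem_rem_uniq ?fset_uniq // => /andP[/negbTE->]; rewrite mul0rz.
rewrite big_seq big1 // => i iS.
have [ij|_] := eqVneq i j; last exact: mul0rz.
by rewrite -ij iS in jS.
Qed.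

Lemma eq_lincomb (I : choiceType) (V : zmodType) (y z : I -> V) S m :
  y =1 z -> lincomb y S m = lincomb z S m.
Proof. by move=> yz; apply: eq_bigr => i _; rewrite yz. Qed.

Lemma lb_neq0 (p : nat) (G : zmodType) (I : choiceType) (x : I -> G) i :
  local_basis p x -> x i != 0.
Proof.
move=> xb; apply/eqP => xi0.
have /(lb_indep xb)/(_ i) : lincomb x [fset i]%fset (fun=> 1) = 0.
  by rewrite /lincomb big_seq_fset1 xi0 mul0rz.
by rewrite in_fset1 eqxx => /(_ isT).
Qed.

(** The fraction (coefficient of g at i) / n is the i-th rational coordinate of g
and does not depend on the chosen representation of g: it is read off after
applying the endomorphism which keeps x_i and kills the other basis elements. *)
Lemma coordinate_unique (p : nat) (G : zmodType) (I : choiceType) (x : I -> G)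
    (g : G) n n' S S' m m' i :
  prime p -> local_basis p x ->
  g *+ n = lincomb x S m -> g *+ n' = lincomb x S' m' ->
  (if i \in S then m i else 0) * n'%:Z = (if i \in S' then m' i else 0) * n%:Z.
Proof.
move=> pp xb; have tfG := lb_torsion_free xb.
have [t tE] := hom_of_basis (fun j => if j == i then x i else 0) pp xb tfG
  (lb_divides xb).
have tS r T l : g *+ r = lincomb x T l ->
    t g *+ r = x i *~ (if i \in T then l i else 0).
  move=> gr; rewrite -raddfMn gr raddf_lincomb (eq_lincomb _ _ tE).
  by rewrite lincomb_delta; case: ifP.
move=> /tS tn /tS tn'; apply/eqP; rewrite -subr_eq0.
apply/negPn/negP => /(torsion_freeMz tfG) xi0.
case/eqP: (lb_neq0 i xb); apply: xi0.
by rewrite mulrzBr !mulrzA -tn -tn' -!pmulrn -!mulrnA mulnC subrr.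
Qed.

(** If p^k divides g, it divides the coordinates of g; a nonzero coordinate
bounds k. *)
Lemma finite_height (p : nat) (G : zmodType) (I : choiceType) (x : I -> G)
    (g : G) :
  prime p -> local_basis p x -> g != 0 ->
  exists k h, g = h *+ p ^ k /\ ~ divides p h.
Proof.
move=> pp xb g0; have [n [S [m [pn gn]]]] := lb_span xb g.
have n_gt0 := prime_coprime_gt0 pp pn.
have [i iS mi0] : exists2 i, i \in S & m i != 0.
  apply: contrapT => nm; case/eqP: g0; apply: lb_torsion_free xb _ _ n_gt0 _.
  rewrite gn /lincomb big_seq; apply: big1 => i iS.
  have [->|mi0] := eqVneq (m i) 0; first by rewrite mulr0z.
  by case: nm; exists i.
(* As n' is prime to p, the factor p^k is in the coefficient of g itself. *)
have div_coef k : divides (p ^ k) g -> (p ^ k %| `|m i|)%N.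
  case=> h gh; have [n' [S' [m' [pn' hn']]]] := lb_span xb h.
  have gn' : g *+ n' = lincomb x S' (fun i => m' i * (p ^ k)%N%:Z).
    rewrite gh mulrnAC hn' /lincomb -sumrMnl; apply: eq_bigr => j _.
    by rewrite mulrzA.
  have := coordinate_unique i pp xb gn gn'; rewrite iS => mE.
  have : (p ^ k %| `|(m i * n'%:Z)%R|)%N.
    rewrite mE; case: ifP => _; last by rewrite mul0r.
    by rewrite !abszM /= mulnAC dvdn_mull.
  by rewrite abszM Gauss_dvdl // coprimeXl.
have: ~ divides (p ^ `|m i|) g.
  move/div_coef => /dvdn_leq; rewrite absz_gt0 mi0 => /(_ isT).
  by rewrite leqNgt ltn_expl ?prime_gt1.
elim: `|m i|%N => [|k IHk] ndiv; first by case: ndiv; exists g.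
have [[h gh]|/IHk//] := pselect (divides (p ^ k) g).
exists k, h; split=> // -[h' hh']; apply: ndiv; exists h'.
by rewrite gh hh' -mulrnA expnS.
Qed.

Lemma coprime_coef (p : nat) (G : zmodType) (I : choiceType) (x : I -> G)
    (h : G) (n : nat) S m :
  prime p -> coprime p n -> h *+ n = lincomb x S m -> ~ divides p h ->
  exists2 j, j \in S & coprime p `|m j|.
Proof.
move=> pp pn hn; apply: contra_notP => nm; apply: (divides_coprime pn).
exists (lincomb x S (fun i => (m i %/ p%:Z)%Z)).
rewrite hn /lincomb -sumrMnl big_seq [RHS]big_seq; apply: eq_bigr => i iS.
rewrite pmulrn -mulrzA divzK // dvdzE /= -[(_ %| _)%N]negbK -prime_coprime //.
by apply/negP => pm; apply: nm; exists i.
Qed.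

(** Some coefficient of n (q c), say the one at j, is prime to p.  Dividing n c
by it gives d, and the map s which sends x_j to d and kills the other basis
elements satisfies s (q c) = c; then t = s q.  All values of t have a nonzero
multiple among the multiples of c, which is why every u fixing c fixes them:
t projects onto the pure subgroup generated by c. *)
Lemma projection_onto_line (p : nat) (G : zmodType) (I : choiceType)
    (x : I -> G) (q : {additive G -> G}) (c : G) :
  prime p -> local_basis p x -> ~ divides p (q c) ->
  exists t : {additive G -> G},
    [/\ t c = c, forall g, q g = 0 -> t g = 0
      & forall u : {additive G -> G}, u c = c -> forall g, u (t g) = t g].
Proof.
move=> pp xb npqc; have [n [S [m [pn qcn]]]] := lb_span xb (q c).
have tfG := lb_torsion_free xb; have n_gt0 := prime_coprime_gt0 pp pn.
have [j jS pmj] := coprime_coef pp pn qcn npqc.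
have [d dE] : exists d, d *~ m j = c *+ n.
  have [d dE] := lb_divides xb (c *+ n) pmj.
  case: (m j) dE => k; first by exists d.
  by exists (- d); rewrite NegzE mulNrz mulrNz opprK dE.
have mj0 : m j != 0 by have := prime_coprime_gt0 pp pmj; rewrite absz_gt0.
have [s sE] := hom_of_basis (fun i => if i == j then d else 0) pp xb tfG
  (lb_divides xb).
have sfix (u : {additive G -> G}) : u c = c -> forall g, u (s g) = s g.
  move=> uc; apply: (@eq_hom_of_basis p G G I x (u \o s) s pp xb tfG) => i /=.
  rewrite sE; case: ifP => _; last exact: raddf0.
  apply/subr0_eq/(torsion_freeMz tfG mj0).
  by rewrite mulrzBl -raddfMz dE raddfMn uc subrr.
exists (s \o q); split=> [|g /= ->|u uc g]; last exact: sfix.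
- apply: (torsion_free_inj tfG n_gt0).
  rewrite /= -raddfMn qcn raddf_lincomb (eq_lincomb _ _ sE).
  by rewrite lincomb_delta jS.
- exact: raddf0.
Qed.

(** * Common complements in finite rank *)

(** The element w is independent of the family because t separates it from the
span.  The induction principle for the members of the new family records where
they come from. *)
Lemma Zindependent_extend (G : zmodType) (n : nat) (v : 'I_n -> G) (w : G)
    (t : {additive G -> G}) :
  torsion_free G -> Zindependent v -> (forall i, t (v i) = 0) -> t w != 0 ->
  exists u : 'I_n.+1 -> G, Zindependent u /\
    forall P : G -> Prop, P w -> (forall i, P (v i)) -> forall i, P (u i).
Proof.
move=> tfG vi tv tw; pose u i := oapp v w (unlift ord0 i).
exists u; split; last by move=> P Pw Pv i; rewrite /u; case: (unlift ord0 i).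
move=> c; rewrite big_ord_recl /u unlift_none /=.
under eq_bigr do rewrite liftK /=.
move=> uc0; have c00 : c ord0 = 0.
  apply/eqP/negPn/negP => /(torsion_freeMz tfG) tw0; case/eqP: tw; apply: tw0.
  move/(congr1 t): uc0; rewrite raddfD raddf0 raddf_sum big1.
    by rewrite addr0 raddfMz.
  by move=> i _; rewrite raddfMz tv mul0rz.
move: uc0; rewrite c00 mulr0z add0r => /vi cv i.
by case: (unliftP ord0 i) => [j|] ->.
Qed.

(** The maps phi and psi restrict to mutually inverse isomorphisms between the
images of e and f; that e and f are idempotent follows. *)
Definition equivalent_idempotents (G : zmodType)
    (e f phi psi : {additive G -> G}) : Prop :=
  [/\ forall g, psi (phi g) = e g, forall g, phi (psi g) = f g,
      forall g, f (phi g) = phi g & forall g, e (psi g) = psi g].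

Lemma equivalent_idempotents_sym (G : zmodType)
    (e f phi psi : {additive G -> G}) :
  equivalent_idempotents e f phi psi -> equivalent_idempotents f e psi phi.
Proof. by case. Qed.

Lemma equivalent_idempotent (G : zmodType) (e f phi psi : {additive G -> G}) :
  equivalent_idempotents e f phi psi -> forall g, e (e g) = e g.
Proof. by case=> ef fe fphi epsi g; rewrite -(ef g) epsi. Qed.

(** Otherwise phi would carry a maximal independent family into the image of f,
and a nonzero element of the kernel of f would extend it. *)
Lemma finite_rank_dedekind_finite (G : zmodType)
    (e f phi psi : {additive G -> G}) :
  torsion_free G -> finite_rank G -> equivalent_idempotents e f phi psi ->
  (forall g, e g = g) -> forall g, f g = g.
Proof.
move=> tfG [n [[v vi] nvi]] ef e1 g; have ff := equivalent_idempotent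
  (equivalent_idempotents_sym ef); case: ef => psiphi _ fphi _.
apply/esym/eqP; rewrite -subr_eq0; apply/negPn/negP => gf0; apply: nvi.
have phivi : Zindependent (phi \o v).
  move=> c /(congr1 psi); rewrite raddf_sum raddf0 => vc0; apply: vi.
  by rewrite -[RHS]vc0; apply: eq_bigr => i _; rewrite raddfMz psiphi e1.
have [||u [ui _]] :=
  @Zindependent_extend G n _ (g - f g) (idfun \- f) tfG phivi.
- by move=> i /=; rewrite fphi subrr.
- by rewrite /= raddfB ff subrr subr0.
- by exists u.
Qed.

(** The kernel of e is pure, so a nonzero element of it can be divided by its
p-part inside the kernel. *)
Lemma nondivisible_complement (p : nat) (G : zmodType) (I : choiceType)
    (x : I -> G) (e : {additive G -> G}) (g : G) :
  prime p -> local_basis p x -> (forall g, e (e g) = e g) -> e g <> g ->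
  exists h, ~ divides p ((idfun \- e) h).
Proof.
move=> pp xb ee eg.
have [|k [h [ghE hp]]] := finite_height (g := g - e g) pp xb.
  by rewrite subr_eq0; apply/eqP => /esym.
exists h; suff eh : e h = 0 by rewrite /= eh subr0.
have pk_gt0 : (0 < p ^ k)%N by rewrite expn_gt0 prime_gt0.
apply: lb_torsion_free xb _ _ pk_gt0 _.
by rewrite -raddfMn -ghE raddfB ee subrr.
Qed.

(** A group is not the union of two proper subgroups; here these are the
preimages of pG under q and r. *)
Lemma avoid_two (p : nat) (G : zmodType) (q r : {additive G -> G}) (h k : G) :
  ~ divides p (q h) -> ~ divides p (r k) ->
  exists c, ~ divides p (q c) /\ ~ divides p (r c).
Proof.
move=> qh rk.
have [rh|rh] := pselect (divides p (r h)); last by exists h.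
have [qk|qk] := pselect (divides p (q k)); last by exists k.
case: rh qk => rh rhE [qk qkE].
exists (h + k); rewrite !raddfD; split=> -[y yE].
- by apply: qh; exists (y - qk); rewrite mulrnBl -yE -qkE addrK.
- by apply: rk; exists (y - rh); rewrite mulrnBl -yE -rhE addrC addKr.
Qed.

(** When t is a projection onto a line that kills the image of e, this is the
idempotent with image im e + im t and kernel the intersection of the kernels of
e and t. *)
Definition add_line (G : zmodType) (e t : {additive G -> G}) :
    {additive G -> G} :=
  e \+ ((idfun \- e) \o t).

(** The equivalence that extends phi by the identity of the line. *)
Definition add_line_equiv (G : zmodType) (phi t : {additive G -> G}) :
    {additive G -> G} :=
  (phi \o (idfun \- t)) \+ t.

Lemma add_lineE (G : zmodType) (e t : {additive G -> G}) g :
  add_line e t g = e g + (t g - e (t g)).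
Proof. by []. Qed.

Lemma add_line_equivE (G : zmodType) (phi t : {additive G -> G}) g :
  add_line_equiv phi t g = phi (g - t g) + t g.
Proof. by []. Qed.

Lemma add_line_id (G : zmodType) (e t : {additive G -> G}) g :
  t g = g -> add_line e t g = g.
Proof. by move=> tg; rewrite add_lineE tg addrC subrK. Qed.

Lemma add_line_ker (G : zmodType) (e t : {additive G -> G}) g :
  (forall g, t (t g) = t g) -> (forall g, t (e g) = 0) ->
  add_line e t g = 0 -> t g = 0 /\ e g = 0.
Proof.
move=> tt te; rewrite add_lineE => e'g.
have tg : t g = 0.
  by move/(congr1 t): e'g; rewrite raddfD raddfB !te tt add0r subr0 raddf0.
by split=> //; move: e'g; rewrite tg raddf0 subrr addr0.
Qed.

(** The maps te and tf project onto the same line, along complements that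
depend on e and f. *)
Lemma equivalent_add_line (G : zmodType)
    (e f phi psi te tf : {additive G -> G}) :
  equivalent_idempotents e f phi psi ->
  (forall g, te (e g) = 0) -> (forall g, tf (f g) = 0) ->
  (forall g, te (tf g) = tf g) -> (forall g, tf (te g) = te g) ->
  equivalent_idempotents (add_line e te) (add_line f tf)
    (add_line_equiv phi te) (add_line_equiv psi tf).
Proof.
have half (e1 f1 phi1 psi1 t1 t2 : {additive G -> G}) :
    equivalent_idempotents e1 f1 phi1 psi1 ->
    (forall g, t2 (f1 g) = 0) -> (forall g, t2 (t1 g) = t1 g) ->
    (forall g, add_line_equiv psi1 t2 (add_line_equiv phi1 t1 g)
      = add_line e1 t1 g) /\
    (forall g, add_line f1 t2 (add_line_equiv phi1 t1 g)
      = add_line_equiv phi1 t1 g).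
  case=> psiphi _ fphi _ t2f t21.
  have t2E g : t2 (add_line_equiv phi1 t1 g) = t1 g.
    by rewrite add_line_equivE raddfD -fphi t2f add0r t21.
  split=> g.
    rewrite [LHS]add_line_equivE; set u := add_line_equiv phi1 t1 g.
    rewrite t2E [u]add_line_equivE addrK psiphi raddfB.
    by rewrite add_lineE addrAC addrA.
  rewrite add_lineE; set u := add_line_equiv phi1 t1 g.
  rewrite t2E [in f1 u]/u add_line_equivE raddfD fphi -addrA; congr (_ + _).
  by rewrite addrC subrK.
move=> ef tee tff tetf tfte.
have [H1 H3] := half _ _ _ _ _ _ ef tff tfte.
have [H2 H4] := half _ _ _ _ _ _ (equivalent_idempotents_sym ef) tee tetf.
by split.
Qed.

(** Then a is idempotent with the same image as e, but possibly another
kernel. *)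
Definition retracts_onto (G : zmodType) (a e : {additive G -> G}) : Prop :=
  (forall g, a (e g) = e g) /\ (forall g, e (a g) = a g).

(** If C is the kernel of a, a complement of im e + im t, then the new
projection onto the image of e has kernel im t + C. *)
Lemma remove_line (G : zmodType) (e t a : {additive G -> G}) :
  (forall g, e (e g) = e g) -> (forall g, t (e g) = 0) ->
  (forall g, t (t g) = t g) -> retracts_onto a (add_line e t) ->
  retracts_onto ((idfun \- t) \o a) e.
Proof.
move=> ee te tt [ae' e'a]; split=> g /=.
  have e'e : add_line e t (e g) = e g.
    by rewrite add_lineE te raddf0 subr0 addr0 ee.
  have -> : a (e g) = e g by rewrite -e'e ae'.
  by rewrite te subr0.
have := e'a g; rewrite add_lineE => uE.
rewrite [LHS]raddfB -[X in _ = X - _]uE -addrA; congr (_ + _).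
by rewrite addrAC subrr add0r.
Qed.

(** The identity a b = a says that the kernel of b lies in that of a. *)
Lemma remove_line_kernel (G : zmodType) (te tf a b : {additive G -> G}) :
  (forall g, a (tf g) = tf g) -> (forall g, te (tf g) = tf g) ->
  (forall g, a (b g) = a g) ->
  forall g, ((idfun \- te) \o a) (((idfun \- tf) \o b) g)
    = ((idfun \- te) \o a) g.
Proof.
move=> atf tetf ab g /=.
by rewrite (raddfB a) ab atf (raddfB te) tetf opprB addrA subrK.
Qed.

(** Two subgroups have a common complement when there are projections onto them
with the same kernel.  The induction is on a strict bound d for the rank of the
kernel of e, which drops when a line is added to the image of e. *)
Lemma common_kernel_projections (p : nat) (G : zmodType) (I : choiceType)
    (x : I -> G) (d : nat) (e f phi psi : {additive G -> G}) :
  prime p -> local_basis p x -> finite_rank G ->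
  equivalent_idempotents e f phi psi ->
  (forall v : 'I_d -> G, (forall i, e (v i) = 0) -> ~ Zindependent v) ->
  exists a b : {additive G -> G},
    [/\ retracts_onto a e, retracts_onto b f,
        forall g, a (b g) = a g & forall g, b (a g) = b g].
Proof.
move=> pp xb rkG; have tfG := lb_torsion_free xb.
elim: d => [|d IHd] in e f phi psi *.
  move=> _ /(_ (fun=> 0)); case; first by move=> i; exact: raddf0.
  by move=> c _ [].
move=> ef nind; have fe := equivalent_idempotents_sym ef.
have ee := equivalent_idempotent ef; have ff := equivalent_idempotent fe.
have [e1|/existsNP[y ey]] := pselect (forall g, e g = g).
  exists idfun, idfun.
  have f1 := finite_rank_dedekind_finite tfG rkG ef e1.
  by split=> //; split=> g //=; rewrite ?e1 ?f1.
have [z fz] : exists z, f z <> z.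
  apply/existsNP => f1; apply: ey.
  exact: finite_rank_dedekind_finite tfG rkG fe f1 y.
have [h hp] := nondivisible_complement pp xb ee ey.
have [k kp] := nondivisible_complement pp xb ff fz.
have [c [cep cfp]] := avoid_two hp kp.
have [te [tec te0 tefix]] := projection_onto_line pp xb cep.
have [tf [tfc tf0 tffix]] := projection_onto_line pp xb cfp.
have tee g : te (e g) = 0 by apply: te0; rewrite /= ee subrr.
have tff g : tf (f g) = 0 by apply: tf0; rewrite /= ff subrr.
have tetf := tffix te tec; have tfte := tefix tf tfc.
have tete := tefix te tec; have tftf := tffix tf tfc.
have [|a [b [ae bf ab ba]]] := IHd _ _ _ _
    (equivalent_add_line ef tee tff tetf tfte).
  move=> v ve' vi.
  have v0 i : te (v i) = 0 /\ e (v i) = 0 by exact: add_line_ker (ve' i).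
  have [||u [ui uP]] := @Zindependent_extend G d v (c - e c) te tfG vi.
  - by move=> i; case: (v0 i).
  - rewrite raddfB tee tec subr0; apply/eqP => c0; apply: cep.
    by rewrite c0 raddf0; exists 0; rewrite mul0rn.
  apply: nind ui; apply: (uP (fun g => e g = 0)).
    by rewrite raddfB ee subrr.
  by move=> i; case: (v0 i).
have atf g : a (tf g) = tf g.
  by rewrite -[tf g](add_line_id e (tetf g)); case: ae => ->.
have bte g : b (te g) = te g.
  by rewrite -[te g](add_line_id f (tfte g)); case: bf => ->.
exists ((idfun \- te) \o a), ((idfun \- tf) \o b); split.
- exact: remove_line.
- exact: remove_line.
- exact: remove_line_kernel.
- exact: remove_line_kernel.
Qed.

Lemma val_subgroupB (G : zmodType) (A : zmodClosed G) (a b : subgroup A) :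
  val (a - b) = val a - val b.
Proof. exact: (raddfB val). Qed.

(** The inverse of the given isomorphism is only known as a function, so psi is
obtained from the converse of the graph of the isomorphism. *)
Lemma isomorphic_equivalent (G : zmodType) (A B : zmodClosed G)
    (e f : {additive G -> G}) :
  (forall g, e g \in A) -> (forall g, g \in A -> e g = g) ->
  (forall g, f g \in B) -> (forall g, g \in B -> f g = g) ->
  isomorphic (subgroup A) (subgroup B) ->
  exists phi psi, equivalent_idempotents e f phi psi.
Proof.
move=> eA eid fB fid [i [j ij ji]].
have [|||phi phiP] := @additive_of_relation G G
    (fun g h => exists a : subgroup A, val a = e g /\ h = val (i a)).
- by move=> g; exists (val (i (Subgroup (eA g)))), (Subgroup (eA g)).
- move=> g g' _ _ [a [ag ->]] [a' [ag' ->]]; exists (a - a').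
  by rewrite (raddfB i) !val_subgroupB ag ag' !raddfB.
- move=> _ [a [ag ->]]; suff -> : a = 0 by rewrite raddf0.
  by apply: val_inj; rewrite ag raddf0.
have [|||psi psiP] := @additive_of_relation G G
    (fun g h => exists a : subgroup A, val (i a) = f g /\ h = val a).
- move=> g; exists (val (j (Subgroup (fB g)))), (j (Subgroup (fB g))).
  by rewrite ji.
- move=> g g' _ _ [a [ag ->]] [a' [ag' ->]]; exists (a - a').
  by rewrite (raddfB i) !val_subgroupB ag ag' !raddfB.
- move=> _ [a [ag ->]]; suff -> : a = 0 by rewrite raddf0.
  by apply/(can_inj ij)/val_inj; rewrite ag !raddf0.
have inA (a : subgroup A) : val a \in A := valP a.
have inB (b : subgroup B) : val b \in B := valP b.
exists phi, psi; split=> g.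
- have [a [ag ->]] := phiP g; have [a' [ag' ->]] := psiP (val (i a)).
  by rewrite -ag; congr val; apply/(can_inj ij)/val_inj; rewrite ag' fid.
- have [a [ag ->]] := psiP g; have [a' [ag' ->]] := phiP (val a).
  rewrite -ag; congr (val (i _)); apply: val_inj; rewrite ag'; exact: eid.
- by have [a [_ ->]] := phiP g; apply: fid.
- by have [a [_ ->]] := psiP g; apply: eid.
Qed.

Lemma finite_rank_perspective (p : nat) (G : zmodType) (I : choiceType)
    (x : I -> G) :
  prime p -> local_basis p x -> finite_rank G -> perspective G.
Proof.
move=> pp xb rkG A H B K /direct_sum2_projection[e [eA eid _]].
move=> /direct_sum2_projection[f [fB fid _]].
move=> /(isomorphic_equivalent eA eid fB fid)[phi [psi ef]].
have [n [_ nind]] := rkG.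
have [|a [b [[ae ea] [bf fb] ab ba]]] :=
  common_kernel_projections (d := n.+1) pp xb rkG ef.
  by move=> v _ vi; apply: nind; exists v.
exists (kernel a : zmodClosed G); split; split=> g.
- exists (a g), (g - a g); split; [by rewrite -ea | | by rewrite addrC subrK].
  have aa : a (a g) = a g by rewrite -(ea g) ae.
  by rewrite inE raddfB aa subrr.
- by move=> gA; rewrite inE -(eid g gA) ae => /eqP.
- exists (b g), (g - b g); split; [by rewrite -fb | | by rewrite addrC subrK].
  by rewrite inE raddfB ab subrr.
- move=> gB; rewrite inE => /eqP ag0.
  by rewrite -(fid g gB) -bf (fid g gB) -ba ag0 raddf0.
Qed.

(** * Perspective groups have finite rank *)

(** The image of s is the kernel of 1 - s t, with complement the kernel of t.
It is isomorphic to G, and G has only the complement 0. *)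
Lemma perspective_dedekind_finite (G : zmodType) (s t : {additive G -> G}) :
  perspective G -> (forall g, t (s g) = g) -> forall g, s (t g) = g.
Proof.
move=> perspG ts; pose q : {additive G -> G} := idfun \- (s \o t).
have top (g : G) : g \in kernel (\0 : {additive G -> G}) by rewrite inE.
have stop (g : G) : s g \in kernel q by rewrite inE /= ts subrr.
have [|||C [[_ GC] [qC _]]] := perspG (kernel (\0 : {additive G -> G}))
    (kernel (idfun : {additive G -> G})) (kernel q) (kernel t).
- split=> g; first by exists g, 0; rewrite addr0 rpred0 top.
  by move=> _; rewrite inE => /eqP.
- split=> g.
    exists (s (t g)), (g - s (t g)); split=> //; last by rewrite addrC subrK.
    by rewrite inE raddfB ts subrr.
  rewrite !inE => /eqP qg /eqP tg.
  by move: qg; rewrite /= tg raddf0 subr0.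
- pose f (g : subgroup (kernel (\0 : {additive G -> G}))) :=
    Subgroup (stop (val g)) : subgroup (kernel q).
  have f_add : zmod_morphism f.
    by move=> g h; apply: val_inj; rewrite val_subgroupB /= -raddfB.
  pose m := GRing.isZmodMorphism.Build _ _ f f_add.
  pose F : {additive subgroup (kernel (\0 : {additive G -> G}))
    -> subgroup (kernel q)} := HB.pack f m.
  exists F.
  exists (fun h => Subgroup (top (t (val h)))) => g; apply: val_inj => /=.
    exact: ts.
  have := valP g; rewrite inE /= subr_eq0 => /eqP.
  by move=> /esym.
- move=> g; have [a [c [aq cC ->]]] := qC g.
  have -> : c = 0 by apply: GC.
  by move: aq; rewrite addr0 inE /= subr_eq0 => /eqP/esym.
Qed.

(** On a sequence of distinct indices the shift has a left inverse, which sends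
the first basis element of the sequence to 0. *)
Lemma perspective_finite_basis (p : nat) (G : zmodType) (I : choiceType)
    (x : I -> G) :
  prime p -> local_basis p x -> perspective G -> finite_set [set: I].
Proof.
move=> pp xb perspG; apply/finite_setPn => /card_leP[f0].
have tfG := lb_torsion_free xb; have divG := lb_divides xb.
pose f n := val (f0 (to_setT n)).
have finj : injective f.
  move=> k l /val_inj kl; have : to_setT k = to_setT l.
    by apply: inj kl; rewrite inE.
  by move/(congr1 val).
pose shift i := if pselect (exists k, i = f k) is left ex
  then x (f (projT1 (cid ex)).+1) else x i.
pose unshift i := if pselect (exists k, i = f k) is left ex
  then (if projT1 (cid ex) is k.+1 then x (f k) else 0) else x i.
have shiftE k : shift (f k) = x (f k.+1).
  rewrite /shift; case: pselect => [ex|[]]; last by exists k.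
  by case: cid => l /= /finj ->.
have unshiftE k : unshift (f k) = if k is k'.+1 then x (f k') else 0.
  rewrite /unshift; case: pselect => [ex|[]]; last by exists k.
  by case: cid => l /= /finj ->.
have [s sE] := hom_of_basis shift pp xb tfG divG.
have [t tE] := hom_of_basis unshift pp xb tfG divG.
have ts : forall g, t (s g) = g.
  apply: (@eq_hom_of_basis p G G I x (t \o s) idfun pp xb tfG) => i /=.
  have [[k ->]|nk] := pselect (exists k, i = f k).
    by rewrite sE shiftE tE unshiftE.
  rewrite sE /shift; case: pselect => // _.
  by rewrite tE /unshift; case: pselect.
have := perspective_dedekind_finite perspG ts (x (f 0%N)).
rewrite tE unshiftE raddf0 => /esym/eqP; exact/negP/(lb_neq0 _ xb).
Qed.

(** A kernel vector over the rationals exists by comparing ranks; multiplying it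
by the product of its denominators makes it integral. *)
Lemma int_kernel_row (m n : nat) (M : 'M[int]_(m, n)) :
  (n < m)%N -> exists2 c : 'I_m -> int,
    exists i, c i != 0 & forall j, \sum_i c i * M i j = 0.
Proof.
move=> nm; pose Q : 'M[rat]_(m, n) := map_mx intr M.
have /rowV0Pn[r /sub_kermxP rQ /rV0Pn[i0 ri0]] : kermx Q != 0.
  rewrite kermx_eq0 /row_free neq_ltn; apply/orP; left.
  exact: leq_ltn_trans (rank_leq_col Q) nm.
pose D := \prod_i denq (r 0 i).
have cE i : (numq (r 0 i) * \prod_(j | j != i) denq (r 0 j))%:~R
    = D%:~R * r 0 i :> rat.
  have -> : D = denq (r 0 i) * \prod_(j | j != i) denq (r 0 j) by exact: bigD1.
  rewrite !intrM [RHS]mulrAC; congr (_ * _).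
  by rewrite mulrC -numqE.
exists (fun i => numq (r 0 i) * \prod_(j | j != i) denq (r 0 j)).
  exists i0; rewrite mulf_neq0 ?numq_eq0 //.
  by apply/prodf_neq0 => j _; rewrite denq_neq0.
move=> j; apply/eqP; rewrite -(intr_eq0 rat) rmorph_sum /=; apply/eqP.
transitivity (D%:~R * (r *m Q) 0 j); last by rewrite rQ mxE mulr0.
rewrite mxE mulr_sumr; apply: eq_bigr => i _.
by rewrite intrM cE mulrA mxE.
Qed.

(** More elements than the basis has are dependent: after multiplication by
their denominators they have integral coordinates. *)
Lemma finite_basis_finite_rank (p : nat) (G : zmodType) (I : choiceType)
    (x : I -> G) :
  prime p -> local_basis p x -> finite_set [set: I] -> finite_rank G.
Proof.
move=> pp xb /finite_fsetP[J JE].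
have inJ i : i \in J by have : [set: I]%classic i by []; rewrite JE.
have bound n (v : 'I_n -> G) : Zindependent v -> (n <= #|` J|)%N.
  move=> vi; rewrite leqNgt; apply/negP => Jn.
  have [N Nspec] := choice (fun i => lb_span xb (v i)).
  have [S Sspec] := choice Nspec; have [m mspec] := choice Sspec.
  pose M : 'M[int]_(n, #|` J|) := \matrix_(i, j)
    (let k := tnth (in_tuple J) j in if k \in S i then m i k else 0).
  have vE i : v i *+ N i = \sum_j x (tnth (in_tuple J) j) *~ M i j.
    have [_ ->] := mspec i.
    rewrite (@lincomb_widen _ _ _ _ J); last by apply/fsubsetP => k _.
    by rewrite /lincomb big_tnth; apply: eq_bigr => j _; rewrite mxE.
  have [c [i0 ci0] cM] := int_kernel_row M Jn.
  have /vi/(_ i0)/eqP : \sum_i v i *~ (c i * (N i)%:Z) = 0.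
    transitivity (\sum_i \sum_j x (tnth (in_tuple J) j) *~ (c i * M i j)).
      apply: eq_bigr => i _; rewrite mulrC mulrzA -pmulrn vE mulrz_suml.
      by apply: eq_bigr => j _; rewrite mulrC mulrzA.
    rewrite exchange_big big1 // => j _.
    by rewrite -mulrz_sumr cM mulr0z.
  rewrite mulf_eq0 (negbTE ci0) /= eqz_nat; apply/negP; rewrite -lt0n.
  by have [pN _] := mspec i0; apply: prime_coprime_gt0 pp pN.
pose P n := `[< exists v : 'I_n -> G, Zindependent v >].
have exP : exists n, P n.
  by exists 0%N; apply/asboolP; exists (fun=> 0) => c _ [].
have ubP n : P n -> (n <= #|` J|)%N by move=> /asboolP[v /bound].
case: (ex_maxnP exP ubP) => n /asboolP vn nmax.
exists n; split=> // vSn; have := nmax n.+1; rewrite ltnn => /(_ _)/negP.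
by apply=> //; apply/asboolP.
Qed.

(** * Bases of homogeneous completely decomposable groups *)

Lemma height_eq_None (G : zmodType) (q : nat) (g : G) :
  height q g = None <-> forall k, divides (q ^ k) g.
Proof.
rewrite /height; split=> [|gq]; last first.
  by apply: xgetPN => _ [k [_ nk] _]; exact: nk.
case: xgetP => [h _ [k _ <-] //|noh _]; elim=> [|k IHk]; first by exists g.
by apply: contrapT => nk; apply: (noh (Some k)); exists k.
Qed.

Lemma height_neq_None (G : zmodType) (q : nat) (g : G) :
  height q g <> None ->
  exists k, divides (q ^ k) g /\ ~ divides (q ^ k.+1) g.
Proof.
by rewrite /height; case: xgetP => [h _ [k kP _] _|//]; exists k.
Qed.

Lemma Qp_inv (p n : nat) : coprime p n -> (n%:R^-1 : rat) \in Qp p.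
Proof.
case: n => [|n] pn; first by rewrite invr0 rpred0.
by rewrite inE -[n.+1%:R]/((n.+1)%:Z%:~R) denqVz.
Qed.

Lemma val_subgroupMn (G : zmodType) (A : zmodClosed G) (a : subgroup A) n :
  val (a *+ n) = val a *+ n.
Proof. exact: (raddfMn val). Qed.

Lemma val_subgroupMz (G : zmodType) (A : zmodClosed G) (a : subgroup A) k :
  val (a *~ k) = val a *~ k.
Proof. exact: (raddfMz val). Qed.

(** The element 1 has p-height 0 and infinite height at every other prime.  Only
the finiteness of heights is recorded, since at a given prime equivalence of
characteristics preserves nothing else. *)
Lemma Qp_unit_char (p : nat) : prime p ->
  exists g : subgroup (Qp p), [/\ g != 0, height p g <> None
    & forall q, prime q -> q <> p -> height q g = None].
Proof.
move=> pp; have Qp1 : (1 : rat) \in Qp p by rewrite inE coprimen1.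
exists (Subgroup Qp1 : subgroup (Qp p)); split.
- apply/eqP => /(congr1 val); apply/eqP; exact: oner_neq0.
- move/height_eq_None/(_ 1%N) => [y /(congr1 val)].
  rewrite val_subgroupMn /= expn1 => yE.
  have p_gt0 := prime_gt0 pp; have := valP y.
  rewrite -[val y](mulfK (x := p%:R)) ?pnatr_eq0 -?lt0n //.
  rewrite mulr_natr -yE mul1r => /=; rewrite inE -[p%:R]/(p%:Z%:~R).
  rewrite denqVz /= ?eqz_nat -?lt0n // /coprime gcdnn => /eqP p1.
  by rewrite p1 in pp.
- move=> q pq qp; apply/height_eq_None => k.
  have pqk : coprime p (q ^ k).
    by rewrite coprimeXr // prime_coprime // dvdn_prime2 //; apply/eqP => /esym.
  exists (Subgroup (Qp_inv pqk)); apply: val_inj; rewrite val_subgroupMn /=.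
  by rewrite -[RHS]mulr_natr mulVf // pnatr_eq0 -lt0n expn_gt0 prime_gt0.
Qed.

Lemma rank1_commensurable (D : zmodType) (x y : D) :
  torsion_free D -> has_rank D 1 -> x != 0 ->
  exists n m, (0 < n)%N /\ y *+ n = x *~ m.
Proof.
move=> tfD [_ nind] x0.
have /existsNP[c /not_implyP[]] :
    ~ Zindependent (fun i : 'I_2 => if i == ord0 then y else x).
  by move=> xy; apply: nind; eexists; exact: xy.
rewrite !big_ord_recl big_ord0 /= addr0.
set c0 := c ord0; set c1 := c _ => c0c1.
have [c00|c00] := eqVneq c0 0.
  case=> i; move: c0c1; rewrite c00 mulr0z add0r => xc1.
  have c10 : c1 = 0.
    by apply/eqP/negPn/negP => /(torsion_freeMz tfD)/(_ xc1)/eqP; apply/negP.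
  case: (unliftP ord0 i) => [j|] -> //.
  by rewrite (ord1 j).
move=> _; exists `|c0|%N, (- c1 * sgz c0); split; first by rewrite absz_gt0.
have yc0 : y *~ c0 = x *~ (- c1).
  by apply/eqP; rewrite mulrNz -addr_eq0 c0c1.
by rewrite pmulrn abszEsg mulrC !mulrzA yc0.
Qed.

(** If n y = m x, then y inherits the infinite q-height of x: split off the
q-part of n, which is absorbed by the divisibility of x, and use that the rest
of n is prime to q. *)
Lemma rank1_divides_prime (D : zmodType) (q : nat) (x y : D) :
  torsion_free D -> has_rank D 1 -> x != 0 -> prime q ->
  (forall k, divides (q ^ k) x) -> divides q y.
Proof.
move=> tfD rkD x0 pq xq.
have [n [m [n_gt0 yn]]] := rank1_commensurable y tfD rkD x0.
have [n' qn' nE] := pfactor_coprime pq n_gt0.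
have [z xE] := xq (logn q n).+1.
apply: (divides_coprime qn'); exists (z *~ m).
apply: (@torsion_free_inj _ _ _ (q ^ logn q n) tfD).
  by rewrite expn_gt0 prime_gt0.
rewrite -mulrnA -nE yn xE expnS.
by rewrite !pmulrn -!mulrzA mulrC.
Qed.

Lemma divides_of_primes (p : nat) (D : zmodType) :
  prime p ->
  (forall q (y : D), prime q -> q <> p -> divides q y) ->
  forall n (y : D), coprime p n -> divides n y.
Proof.
move=> pp divq; elim/ltn_ind=> n IHn y pn.
have [n1|n_gt1] := leqP n 1.
  have := prime_coprime_gt0 pp pn; case: n n1 {IHn pn} => [|[]] // _ _.
  by exists y; rewrite mulr1n.
have pq := pdiv_prime n_gt1; set q := pdiv n in pq.
have nE : n = (n %/ q * q)%N by rewrite divnK // pdiv_dvd.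
move: pn; rewrite nE coprimeMr => /andP[pn pq'].
have [||y1 ->] := divq q y => //.
  move=> qp; move: pq'; rewrite qp /coprime gcdnn => /eqP p1.
  by rewrite p1 in pp.
have [|y2 ->] := IHn (n %/ q)%N _ y1 pn; last by exists y2; rewrite mulrnA.
by rewrite ltn_Pdiv ?prime_gt1 // (ltn_trans _ n_gt1).
Qed.

(** In n y = m x the factors p of n can be cancelled one at a time, since they
divide m: otherwise p would divide x. *)
Lemma rank1_generator (p : nat) (D : zmodType) (x y : D) :
  prime p -> torsion_free D -> has_rank D 1 -> x != 0 -> ~ divides p x ->
  exists n m, coprime p n /\ y *+ n = x *~ m.
Proof.
move=> pp tfD rkD x0 px.
have [n [m [n_gt0 yn]]] := rank1_commensurable y tfD rkD x0.
have [n' pn' nE] := pfactor_coprime pp n_gt0.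
move: yn; rewrite nE; elim: (logn p n) m => [|a IHa] m.
  by rewrite expn0 muln1; exists n', m.
rewrite expnSr mulnA mulrnA => yE.
have pm : (p%:Z %| m)%Z.
  rewrite dvdzE /= -[(_ %| _)%N]negbK -prime_coprime //; apply/negP => pm.
  apply: px; apply: (divides_coprime pm).
  exists (y *+ (n' * p ^ a) *~ sgz m).
  rewrite pmulrn [(`|m|%N)%:Z]abszEsg mulrC mulrzA -yE.
  by rewrite ![_ *+ p]pmulrn -!mulrzA mulrC.
case/dvdzP: pm yE => m' ->; rewrite mulrzA -pmulrn.
by move=> /(torsion_free_inj tfD (prime_gt0 pp))/IHa.
Qed.

(** The type provides x with finite p-height and infinite height at the other
primes; dividing x by the highest possible power of p gives the generator. *)
Lemma rank1_local (p : nat) (D : zmodType) :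
  prime p -> torsion_free D -> has_rank D 1 ->
  type_of D = type_of (subgroup (Qp p)) ->
  exists x : D, [/\ x != 0, forall n (y : D), coprime p n -> divides n y
    & forall y, exists n m, coprime p n /\ y *+ n = x *~ m].
Proof.
move=> pp tfD rkD tD; have [g [g0 gp gq]] := Qp_unit_char pp.
have : type_of D (char_of g).
  rewrite tD; exists g => //; split=> [|q /(_ erefl)//].
  by apply: sub_finite_set (finite_set0 _) => q /(_ erefl).
case=> x x0 [_ xg].
have xgN q : prime q -> (height q x = None) <-> (height q g = None).
  move=> pq; pose q' : prime_index := exist _ q pq.
  have := xg q'; rewrite /char_of /= => xgq.
  by split=> hN; apply: contrapT => h'N; case: xgq; rewrite hN // => /esym.
have [k [[z xE] nz]] : exists k, divides (p ^ k) x /\ ~ divides (p ^ k.+1) x.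
  by apply: height_neq_None => /(xgN p pp).
have z0 : z != 0 by apply: contraNneq x0 => z0; rewrite xE z0 mul0rn.
exists z; split=> //.
- apply: divides_of_primes => // q y pq qp.
  apply: (rank1_divides_prime _ tfD rkD x0 pq).
  by apply/height_eq_None/xgN => //; exact: gq.
- move=> y; apply: rank1_generator => // -[w zE]; apply: nz; exists w.
  by rewrite xE zE -mulrnA expnS.
Qed.

(** The generators of the rank 1 summands form the basis; the denominator of g
is the product of the denominators of its components. *)
Lemma hcd_local_basis (p : nat) (G : zmodType) :
  prime p ->
  homogeneous_completely_decomposable G (type_of (subgroup (Qp p))) ->
  exists (I : choiceType) (x : I -> G), local_basis p x.
Proof.
move=> pp [I [A [[span indep] rank1]]].
have bex : forall i, exists b : subgroup (A i),
    [/\ b != 0, forall n (y : subgroup (A i)), coprime p n -> divides n y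
      & forall y, exists n m, coprime p n /\ y *+ n = b *~ m].
  by move=> i; case: (rank1 i) => tf rk ty; exact: rank1_local.
pose b i := projT1 (cid (bex i)); have bP i := projT2 (cid (bex i)).
exists I, (fun i => val (b i)).
have tfA i : torsion_free (subgroup (A i)) by case: (rank1 i).
have bA i : val (b i) \in A i := valP (b i).
split.
- move=> g n n_gt0 gn; have [S [a [aA gE]]] := span g.
  rewrite gE big_seq big1 // => i iS.
  move: gn; rewrite gE -sumrMnl => /indep an0.
  have := tfA i (Subgroup (aA i)) n n_gt0 => /(_ _)/(congr1 val); apply.
  apply: val_inj; rewrite val_subgroupMn; apply: an0 => // j.
  exact: rpredMn.
- move=> n g pn; have [S [a [aA ->]]] := span g.
  have cex : forall i, divides n (a i).
    move=> i; case: (bP i) => _ /(_ n (Subgroup (aA i)) pn)[y].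
    by move=> /(congr1 val); rewrite val_subgroupMn; exists (val y).
  have [c cE] := choice cex.
  exists (\sum_(i <- S) c i); rewrite -sumrMnl; exact: eq_bigr.
- move=> g; have [S [a [aA ->]]] := span g.
  have nmex : forall i, exists n m,
      coprime p n /\ a i *+ n = val (b i) *~ m.
    move=> i; case: (bP i) => _ _ /(_ (Subgroup (aA i)))[n [m [pn]]].
    move=> /(congr1 val).
    by rewrite val_subgroupMn val_subgroupMz; exists n, m.
  have [n mex] := choice nmex; have [m nm] := choice mex.
  exists (\prod_(i <- S) n i)%N, S.
  exists (fun i => m i * (\prod_(j <- S | j != i) n j)%N%:Z).
  split.
    apply: (big_ind (coprime p)) => [|k l pk pl|i _]; first exact: coprimen1.
      by rewrite coprimeMr pk pl.
    by case: (nm i).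
  rewrite -sumrMnl /lincomb big_seq [RHS]big_seq; apply: eq_bigr => i iS.
  rewrite (bigD1_seq i) ?fset_uniq //= mulrnA mulrzA -pmulrn.
  by case: (nm i) => _ ->.
- move=> S m /indep bm i iS; apply/eqP/negPn/negP => mi0.
  case: (bP i) => /eqP + _ _; apply; apply: (torsion_freeMz (tfA i) mi0).
  apply: val_inj; rewrite val_subgroupMz; apply: bm => // j; exact: rpredMz.
Qed.

(** * Perspectivity and finite rank *)

Theorem proposition3p17 (p : nat) (G : zmodType) :
  prime p ->
  homogeneous_completely_decomposable G (type_of (subgroup (Qp p))) ->
  (perspective G <-> finite_rank G).
Proof.
move=> pp /(hcd_local_basis pp)[I [x xb]]; split; last first.
  exact: finite_rank_perspective xb.
move/(perspective_finite_basis pp xb); exact: finite_basis_finite_rank xb.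
Qed.
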